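(* Let $f$ be a canonical function whose bounded density shift $X_f$ has positive topological entropy. Then $X_f$ is surjunctive.
   Context: A function $f:\mathbb{N}_0\to[0,\infty)$ is canonical if $f(0)=0$, $f(k+1)\ge f(k)$ for all $k\ge 0$, and $f(k+n)\le f(k)+f(n)$ for all $k,n\in\mathbb{N}$. The bounded density shift associated to a canonical function $f$ is $$X_f=\Big\{x\in(\mathbb{N}_0)^{\mathbb{Z}}:\ \forall p\in\mathbb{N},\ \forall i\in\mathbb{Z},\ \sum_{r=i}^{i+p-1}x_r\le f(p)\Big\},$$ which is a subshift (closed, shift-invariant set) over the alphabet $\{0,1,\dots,\lfloor f(1)\rfloor\}$, with the shift map $\sigma$ given by $(\sigma x)_i=x_{i+1}$. The topological entropy of a subshift $X$ is $h_{top}(X)=\lim_{n\to\infty}\frac1n\log|\mathcal{L}_n(X)|$, where $\mathcal{L}_n(X)$ is the set of words of length $n$ appearing in points of $X$. A shift-endomorphism of a subshift $X$ is a continuous map $\phi:X\to X$ commuting with $\sigma$; it is a shift-automorphism if it is bijective. A subshift $X$ is surjunctive if every injective shift-endomorphism of $X$ is a shift-automorphism. *)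

(* Defs.v *)
From mathcomp Require Import all_boot all_order all_algebra.
From mathcomp Require Import finmap.
From mathcomp Require Import all_classical all_reals all_analysis.

Set Implicit Arguments.
Unset Strict Implicit.
Unset Printing Implicit Defensive.

Import Order.TTheory GRing.Theory Num.Theory.
Import numFieldNormedType.Exports.

Local Open Scope classical_set_scope.
Local Open Scope ring_scope.

(* The full shift over the alphabet nat (with its discrete topology), with the
   product topology. A subshift over {0, ..., m} is regarded as a subset of it;
   its topology is the same as the one inherited from {0, ..., m}^Z. *)
Definition config := {ptws int -> nat}.

Definition sigma (x : config) : config := fun i : int => x (i + 1).

Definition subshift (X : set config) : Prop :=
  [/\ closed X, sigma @` X = X &
      exists m : nat, forall x, X x -> forall i, (x i <= m)%N].

Definition language (X : set config) (n : nat) : set (n.-tuple nat) :=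
  [set w | exists2 x, X x &
     exists i : int, forall j : 'I_n, tnth w j = x (i + (j : nat)%:Z)].
Arguments language X n : clear implicits.

(* fset_set is the finite set underlying a finite set, and is empty on infinite
   sets; languages of subshifts are finite (finite_language below). *)
Definition htop (R : realType) (X : set config) : R :=
  lim ((fun n : nat => ln (#|` fset_set (language X n)|%:R : R) / n%:R) @ \oo).

(* A self-map of X is represented by a map on the whole space, whose values
   outside X are irrelevant. *)
Definition shift_endomorphism (X : set config) (phi : config -> config) : Prop :=
  [/\ set_fun X X phi, {within X, continuous phi} &
      forall x, X x -> phi (sigma x) = sigma (phi x)].

Definition shift_automorphism (X : set config) (phi : config -> config) : Prop :=
  shift_endomorphism X phi /\ set_bij X X phi.

Definition surjunctive (X : set config) : Prop :=
  forall phi : config -> config,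
    shift_endomorphism X phi -> set_inj X phi -> shift_automorphism X phi.

Definition canonical_function (R : realType) (f : nat -> R) : Prop :=
  [/\ forall k, 0 <= f k,
      f 0%N = 0,
      forall k, f k <= f k.+1 &
      forall k n, (0 < k)%N -> (0 < n)%N -> f (k + n)%N <= f k + f n].

Definition bounded_density_shift (R : realType) (f : nat -> R) : set config :=
  [set x : config | forall p : nat, (0 < p)%N -> forall i : int,
     (\sum_(r < p) x (i + (r : nat)%:Z)%R)%N%:R <= f p].

Lemma finite_language (X : set config) (n : nat) :
  subshift X -> finite_set (language X n).
Proof.
move=> [_ _ [m Xm]].
apply: (@sub_finite_set _ _
  (range (fun t : n.-tuple 'I_m.+1 => [tuple (tnth t j : nat) | j < n]))); last first.
  exact/finite_image/finite_finset.
move=> w [x Xx [i wx]].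
exists [tuple inord (tnth w j) | j < n] => //.
apply: eq_from_tnth => j; rewrite !tnth_mktuple inordK //.
by rewrite wx ltnS Xm.
Qed.

Lemma bounded_density_shift_subshift (R : realType) (f : nat -> R) :
  canonical_function f -> subshift (bounded_density_shift f).
Proof.
move=> [f0 _ _ _]; split.
- have -> : bounded_density_shift f = \bigcap_(q in [set q : nat * int | (0 < q.1)%N])
    [set x : config | (\sum_(r < q.1) x (q.2 + (r : nat)%:Z)%R)%N%:R <= f q.1].
    apply/seteqP; split => [x Xx [p i] p0|x Xx p p0 i]; first exact: Xx.
    exact: (Xx (p, i)).
  refine (closed_bigI _) => -[p i] _ /=.
  have cts : continuous (fun x : config => (\sum_(r < p) x (i + (r : nat)%:Z)%R)%N).
    move=> x A /= Ax.
    have xr (r : 'I_p) : nbhs x [set y : config | y (i + (r : nat)%:Z) = x (i + (r : nat)%:Z)].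
      have /(_ [set x (i + (r : nat)%:Z)]) :=
        @proj_continuous int (fun _ => nat) (i + (r : nat)%:Z) x.
      apply; apply: open_nbhs_nbhs; split => //; exact: discrete_open.
    apply: (@filterS _ (nbhs x) _ _ _ _ (filter_forall _ xr)) => y yx /=.
    by under eq_bigr do rewrite yx; exact: nbhs_singleton.
  have -> : [set x : config | (\sum_(r < p) x (i + (r : nat)%:Z)%R)%N%:R <= f p] =
     (fun x : config => (\sum_(r < p) x (i + (r : nat)%:Z)%R)%N) @^-1`
       [set k : nat | k%:R <= f p] by [].
  by move/continuous_closedP: cts; apply; apply: discrete_closed.
- have shift_closed (x : config) (c : int) : bounded_density_shift f x ->
      bounded_density_shift f (fun i => x (i + c)).
    move=> Xx p p0 i; have := Xx p p0 (i + c).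
    by under eq_bigr do rewrite addrAC.
  apply/seteqP; split => [_ [x Xx <-]|x Xx]; first exact: shift_closed.
  exists (fun i => x (i - 1)); first exact: shift_closed.
  by apply/funext => i; rewrite /sigma addrK.
- exists (Num.truncn (f 1%N)) => x Xx i; rewrite truncn_ge_nat //.
  by have := Xx 1%N isT i; rewrite big_ord1 addr0.
Qed.

(* Main.v *)
Require Import Defs.
From mathcomp Require Import all_boot all_order all_algebra.
From mathcomp Require Import finmap zify ring lra.
From mathcomp Require Import all_classical all_reals all_analysis.

Set Implicit Arguments.
Unset Strict Implicit.
Unset Printing Implicit Defensive.

Import Order.TTheory GRing.Theory Num.Theory.
Import numFieldNormedType.Exports.

Local Open Scope classical_set_scope.
Local Open Scope ring_scope.

(** Periodic points are dense in a bounded density shift of positive entropy,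
    and a subshift X with dense periodic points is surjunctive.

    For the second fact, an injective endomorphism phi of X maps the set of
    points of X fixed by sigma^P injectively into itself. This set is finite,
    so phi permutes it, and the image of phi contains every periodic point of
    X. The image is also compact, hence closed, so it contains the closure of
    the periodic points, which is X (dense_periodic_surjunctive).

    For the first fact, positive entropy yields alpha > 0 with
    f p >= alpha * p for all p. Otherwise f p / p takes arbitrarily small
    values and, by subadditivity, f n / n tends to 0; then the words of length
    n in the language have letter sum o(n), and their number grows
    subexponentially, so the entropy is 0 (cvg_entropy0). Given alpha,
    cut a word w out of a point x of X and repeat w 0^G periodically.
    A stretch of length at most G meets at most one copy of w, so it satisfies
    the constraints because x does. Longer stretches have density at most
    about (sum of w) / G, which is below alpha once G is large. Hence the
    periodic point lies in X (periodization_bounded_density), and longer and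
    longer words w give periodic points converging to x. *)

(** * Subshifts with dense periodic points *)

Definition periodic_points (X : set config) (P : nat) : set config :=
  [set y | X y /\ iter P sigma y = y].

Lemma iter_sigmaE P (x : config) i : iter P sigma x i = x (i + P%:Z).
Proof.
elim: P i => [|P IH] i /=; first by rewrite addr0.
by rewrite /sigma IH; congr x; lia.
Qed.

Lemma finite_self_inj_surj (T : choiceType) (A : set T) (g : T -> T) :
  finite_set A -> set_fun A A g -> set_inj A g -> A `<=` g @` A.
Proof.
move=> finA gA ginj; have fingA : finite_set (g @` A) by exact: finite_image.
suff -> : g @` A = A by [].
apply: fset_set_inj => //.
apply/eqP; rewrite eqEfcard; apply/andP; split.
  rewrite -fset_set_sub// => _ [x Ax <-]; exact: gA.
rewrite fset_set_image// card_in_imfset//= => x y.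
by rewrite !in_fset_set//; exact: ginj.
Qed.

Section Subshift.
Variable X : set config.
Hypothesis subX : subshift X.

Lemma subshift_sigma x : X x -> X (sigma x).
Proof. by case: subX => _ sX _ Xx; rewrite -sX; exists x. Qed.

(** A closed subset of the product of the finite alphabets. *)
Lemma subshift_compact : compact X.
Proof.
case: subX => clX _ [m Xm].
apply: (subclosed_compact clX (@tychonoff int (fun _ => nat)
  (fun _ => [set k | (k <= m)%N]) _)) => [_|x Xx i]; last exact: Xm.
exact/finite_compact/(sub_finite_set _ (finite_II m.+1)).
Qed.

(** Such a point is determined by its P letters at 0, ..., P - 1, each of them
    taken from a finite alphabet. *)
Lemma finite_periodic_points P : (0 < P)%N -> finite_set (periodic_points X P).
Proof.
move=> P0; case: subX => _ _ [m Xm].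
pose w (x : config) : {ffun 'I_P -> 'I_m.+1} := [ffun j : 'I_P => inord (x (j : nat)%:Z)].
have winj : set_inj (periodic_points X P) w.
  move=> x y /set_mem[Xx xP] /set_mem[Xy yP] wxy.
  have per (z : config) : iter P sigma z = z -> forall i, z i = z (i %% P)%Z.
    move=> zP.
    have zk (k : nat) i : z (i + (k * P)%N%:Z) = z i.
      elim: k i => [|k IH] i; first by rewrite addr0.
      by rewrite mulSn PoszD addrA IH -iter_sigmaE zP.
    move=> i; case: (intP (i %/ P)%Z) (divz_eq i P) => [|k|k] e.
    - by rewrite {1}e mul0r add0r.
    - by rewrite {1}e addrC -PoszM zk.
    - by rewrite -(zk k.+1 i) {1}e PoszM; congr z; lia.
  apply/funext => i; rewrite (per x xP) (per y yP).
  have [j ->] : exists j : 'I_P, (i %% P)%Z = (j : nat)%:Z.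
    have := modz_ge0 i (_ : P%:Z != 0); have := ltz_mod i (_ : P%:Z != 0).
    case: (i %% P)%Z => k => [klt _|_ /(_ _)]; last by lia.
    have kP : (k < P)%N by lia.
    by exists (Ordinal kP).
  move/ffunP/(_ j)/(congr1 val): wxy; rewrite !ffunE /=.
  by rewrite !inordK// ltnS; exact: Xm.
by rewrite -(eq_finite_set (inj_card_eq winj)); exact: finite_finset.
Qed.

(** Pigeonhole on each finite set of points of a given period makes the image
    contain all periodic points; compactness makes it closed. *)
Lemma dense_periodic_surjunctive :
  X `<=` closure (\bigcup_(P in [set P | (0 < P)%N]) periodic_points X P) ->
  surjunctive X.
Proof.
move=> dense phi [phiX ctsphi phis] injphi; split => //; split => // x Xx.
have hconfig : hausdorff_space config.
  by apply: hausdorff_product => _; exact: discrete_hausdorff.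
have : closed (phi @` X).
  exact/(compact_closed hconfig)/(continuous_compact ctsphi)/subshift_compact.
move=> /closure_id ->; apply: closureS (dense _ Xx) => y [P P0 yP].
have iterX k z : X z -> X (iter k sigma z).
  by move=> Xz; elim: k => //= k; exact: subshift_sigma.
have phiP : set_fun (periodic_points X P) (periodic_points X P) phi.
  move=> z [Xz zP]; split; first exact: phiX.
  suff -> : iter P sigma (phi z) = phi (iter P sigma z) by rewrite zP.
  by elim: (P) => //= k ->; rewrite phis//; exact: iterX.
have [|z [Xz _] <-] :=
  finite_self_inj_surj (finite_periodic_points P0) phiP _ yP; last by exists z.
by move=> u v /set_mem[Xu _] /set_mem[Xv _]; apply: injphi; exact: mem_set.
Qed.

End Subshift.

(** * Zero entropy when f grows sublinearly *)

Section Entropy.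
Variable R : realType.

(** Weighting each word g by t ^ (sum of g), the total weight of all words
    factors as (1 + t + ... + t ^ M) ^ n, and each word counted on the left has
    weight at least t ^ s because t <= 1. *)
Lemma card_words_le (M n s : nat) (t : R) : 0 <= t <= 1 ->
  #|[set g : {ffun 'I_n -> 'I_M.+1} | (\sum_j g j <= s)%N]%SET|%:R * t ^+ s
    <= (1 + M%:R * t) ^+ n.
Proof.
move=> /andP[t0 t1].
have -> : (1 + M%:R * t) ^+ n = \prod_(j < n) (1 + M%:R * t).
  by rewrite prodr_const card_ord.
have gf : \sum_(k < M.+1) t ^+ k <= 1 + M%:R * t.
  rewrite big_ord_recl expr0 lerD2l.
  apply: le_trans (_ : \sum_(k < M) t <= _).
    by apply: ler_sum => k _; rewrite exprS ler_piMr// exprn_ile1.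
  by rewrite sumr_const card_ord mulr_natl.
apply: le_trans (_ : \prod_(j < n) \sum_(k < M.+1) t ^+ k <= _); last first.
  by apply: ler_prod => j _; rewrite gf sumr_ge0// => k _; rewrite exprn_ge0.
rewrite bigA_distr_bigA /= mulr_natl -sumr_const big_mkcond/=.
apply: ler_sum => g _; rewrite prodrXr; case: ifP => [|_].
  by rewrite inE; exact: ler_wiXn2l.
exact: exprn_ge0.
Qed.

Variable f : nat -> R.
Hypothesis canf : canonical_function f.

Let f0 k : 0 <= f k. Proof. by case: canf. Qed.

Lemma canonical_function_le m n : (m <= n)%N -> f m <= f n.
Proof. by case: canf => _ _ /nondecreasing_seqP + _; apply. Qed.

Lemma canonical_function_subadd m n : f (m + n)%N <= f m + f n.
Proof.
case: canf => _ f00 _ fD; case: m n => [|m] [|n]; rewrite ?addn0 ?f00 ?addr0 ?add0r//.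
exact: fD.
Qed.

(** The step behind Fekete's lemma: cut [0, n) into blocks of length m and a
    shorter remainder. *)
Lemma canonical_function_mean m n : (0 < m)%N -> f n <= n%:R * (f m / m%:R) + f m.
Proof.
move=> m0; rewrite {1}(divn_eq n m).
have fM q : f (q * m)%N <= q%:R * f m.
  elim: q => [|q IH]; first by rewrite !mul0n mul0r; case: canf => _ -> _ _.
  rewrite mulSn; apply: le_trans (canonical_function_subadd _ _) _.
  by rewrite -natr1 mulrDl mul1r addrC lerD2r.
apply: le_trans (canonical_function_subadd _ _) _; apply: lerD.
  apply: le_trans (fM _) _; rewrite mulrCA -[leLHS]mulrC ler_wpM2l//.
  by rewrite ler_pdivlMr ?ltr0n// -natrM ler_nat leq_divM.
by apply: canonical_function_le; exact/ltnW/ltn_pmod.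
Qed.

(** The letters are bounded by f 1 and the letter sum of a word of length n by
    f n, so the weighted count of words applies. *)
Lemma card_language_le n (t : R) : 0 <= t <= 1 ->
  #|` fset_set (language (bounded_density_shift f) n)|%:R * t ^+ Num.truncn (f n)
    <= (1 + (Num.truncn (f 1%N))%:R * t) ^+ n.
Proof.
move=> t01; apply: le_trans (card_words_le _ _ _ t01).
apply: ler_wpM2r; first by apply: exprn_ge0; case/andP: t01.
rewrite ler_nat; set A := [set g | _]%SET; set M := Num.truncn (f 1%N).
pose E (g : {ffun 'I_n -> 'I_M.+1}) := [tuple (g j : nat) | j < n].
apply: leq_trans (_ : #|` [fset E g | g in A]%fset| <= _)%N; last first.
  by apply: leq_trans (leq_imfset_card _ _ _) _; rewrite cardE.
apply/fsubset_leq_card/fsubsetP => w.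
rewrite in_fset_set; last exact/finite_language/bounded_density_shift_subshift.
move=> /set_mem[x Xx [i wx]].
have le_letter k : (x k <= M)%N.
  by rewrite truncn_ge_nat//; have := Xx 1%N isT k; rewrite big_ord1 addr0.
apply/imfsetP; exists [ffun j => inord (tnth w j)]; last first.
  by apply: eq_from_tnth => j; rewrite tnth_mktuple ffunE inordK// wx ltnS.
rewrite inE truncn_ge_nat//.
under eq_bigr => j _ do rewrite ffunE inordK ?wx ?ltnS//.
case: n {A E w wx} => [|n]; first by rewrite big_ord0.
exact: Xx.
Qed.

(** Taking logarithms in card_language_le gives
    ln |L_n| / n <= (f n / n) * (- ln t) + M * t. First t is chosen small, to
    control the second term, and then f n / n is made small compared with
    1 / (- ln t). *)
Lemma cvg_entropy0 :
  (forall e, 0 < e -> exists2 p, (0 < p)%N & f p <= e * p%:R) ->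
  (ln #|` fset_set (language (bounded_density_shift f) n)|%:R / n%:R : R)
    @[n --> \oo] --> (0 : R).
Proof.
move=> small; apply/cvgr0Pnorm_le => e e0.
set M : R := (Num.truncn (f 1%N))%:R.
have M0 : 0 <= M by [].
(* Three terms of size e / 3 bound ln |L_n| / n: M * t and, multiplied by - ln t, the
   mean f m / m over blocks and the remainder f m / n. *)
pose t : R := Num.min 1 (e / 3 / (M + 1)).
have t0 : 0 < t by rewrite lt_min ltr01 divr_gt0// ?divr_gt0//; lra.
have t1 : t <= 1 by rewrite ge_min lexx.
have Mt : M * t <= e / 3.
  apply: le_trans (_ : M * (e / 3 / (M + 1)) <= _).
    by rewrite ler_wpM2l// ge_min lexx orbT.
  rewrite mulrA ler_pdivrMr; last lra.
  by rewrite mulrC ler_pM2l; lra.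
pose c := - ln t; have c0 : 0 <= c by rewrite oppr_ge0 ln_le0.
have ec0 : 0 < e / 3 / (c + 1) by rewrite divr_gt0// ?divr_gt0//; lra.
have [m m0 fm] := small _ ec0.
near=> n.
have n0 : (0 < n)%N by near: n; exact: nbhs_infty_gt.
have nR : 0 < n%:R :> R by rewrite ltr0n.
have fmc : f m * c <= n%:R * (e / 3).
  rewrite -ler_pdivrMr; last lra.
  by near: n; exact: nbhs_infty_ger.
have fn : f n * c <= n%:R * (e / 3) + n%:R * (e / 3).
  apply: le_trans (_ : (n%:R * (f m / m%:R) + f m) * c <= _).
    by rewrite ler_wpM2r// canonical_function_mean.
  rewrite mulrDl lerD// -mulrA ler_wpM2l//.
  apply: le_trans (_ : e / 3 / (c + 1) * c <= _).
    by rewrite ler_wpM2r// ler_pdivrMr// ltr0n.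
  rewrite mulrAC ler_pdivrMr; last lra.
  by rewrite ler_pM2l; lra.
set N := #|` _|.
have lnN0 : 0 <= ln N%:R :> R.
  by case: N => [|N]; [rewrite ln0|apply: ln_ge0; rewrite ler1n].
rewrite ger0_norm; last by rewrite divr_ge0.
rewrite ler_pdivrMr//.
have [N0|Npos] := posnP N.
  by rewrite N0 ln0// mulr_ge0// ltW.
have Nt := @card_language_le n t; rewrite (ltW t0) t1 in Nt.
have {Nt} := Nt isT; rewrite -/N -/M.
rewrite -ler_ln ?posrE; [|by rewrite mulr_gt0 ?exprn_gt0 ?ltr0n|by rewrite exprn_gt0//; nra].
rewrite lnM ?posrE ?ltr0n ?exprn_gt0// !lnXn//; last by nra.
have ln1Mt : ln (1 + M * t) <= M * t by apply: le_ln1Dx; nra.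
rewrite -[ln t *+ _]mulr_natl -[ln (1 + _) *+ _]mulr_natl => H.
have s1 : (Num.truncn (f n))%:R * c <= f n * c.
  by rewrite ler_wpM2r// truncn_le.
have s2 : n%:R * ln (1 + M * t) <= n%:R * (e / 3).
  by rewrite ler_wpM2l//; lra.
have -> : e * n%:R = n%:R * (e / 3) + n%:R * (e / 3) + n%:R * (e / 3) by field.
have : (Num.truncn (f n))%:R * ln t = - ((Num.truncn (f n))%:R * c).
  by rewrite /c mulrN opprK.
lra.
Unshelve. all: by end_near.
Qed.

End Entropy.

(** * Density of periodic points when f grows linearly *)

Definition window (x : config) (a : int) (W : nat) : config :=
  fun i => if (a <= i) && (i < a + W%:Z) then x i else 0%N.

(** The bi-infinite repetition of w 0^G, where w is the word of length W that
    x has at position a. *)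
Definition periodization (x : config) (a : int) (W G : nat) : config :=
  fun i => window x a W (a + ((i - a) %% (W + G)%N)%Z).

(** Writing window x a W as a sum of W point masses, each of them is met at
    most once by a given stretch of positions. *)
Lemma sum_window_le x a W i p :
  (\sum_(r < p) window x a W (i + (r : nat)%:Z)%R <= \sum_(k < W) x (a + (k : nat)%:Z)%R)%N.
Proof.
have windowE j : window x a W j =
    (\sum_(k < W) if (a + (k : nat)%:Z == j)%R then x j else 0)%N.
  rewrite /window; case: ifP => [/andP[aj jW]|ajW]; last first.
    rewrite big1// => k _; case: eqP => // e.
    by move: ajW (ltn_ord k); rewrite -e; lia.
  have kW : (`|j - a| < W)%N by lia.
  rewrite (bigD1 (Ordinal kW))//= ifT; last by apply/eqP; lia.
  rewrite big1 ?addn0// => k kj; rewrite ifF//; apply/negbTE.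
  apply: contra kj => /eqP kj; apply/eqP/val_inj => /=; lia.
under eq_bigr do rewrite windowE.
rewrite exchange_big /=; apply: leq_sum => k _.
have [[r kr]|nor] := pselect (exists r : 'I_p, a + (k : nat)%:Z = i + (r : nat)%:Z).
  rewrite (bigD1 r)//= kr eqxx big1 ?addn0// => s sr.
  rewrite ifF//; apply/negbTE; apply: contra sr => /eqP sr; apply/eqP/val_inj => /=; lia.
by rewrite big1// => r _; case: eqP => // kr; exfalso; apply: nor; exists r.
Qed.

(** A stretch of length at most G meets at most one copy of w, because
    consecutive copies are separated by G zeros. The position i' is i moved
    by the multiple of the period that carries this copy to the original
    one. *)
Lemma periodization_window x a W G i p : (p <= G)%N ->
  exists i' : int, forall r, (r < p)%N ->
    (periodization x a W G (i + r%:Z)%R <= window x a W (i' + r%:Z)%R)%N.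
Proof.
move=> pG; have [W0|Wpos] := posnP (W + G).
  by exists 0 => r rp; lia.
set q := ((i - a) %/ (W + G)%N%:Z)%Z; set j := ((i - a) %% (W + G)%N%:Z)%Z.
have ij : i - a = q * (W + G)%N%:Z + j by exact: divz_eq.
have j0 : 0 <= j by apply: modz_ge0; lia.
have jP : j < (W + G)%N%:Z by apply: ltz_pmod; lia.
have E r : periodization x a W G (i + r%:Z) =
    window x a W (a + ((j + r%:Z) %% (W + G)%N%:Z)%Z).
  by rewrite /periodization addrAC ij -addrA modzMDl.
(* j is the phase of i in its period. If the stretch starts inside a copy of w,
   it ends before the next copy; if it starts in the gap, it can only meet the
   copy of the next period. *)
have [jW|Wj] := ltP j W%:Z.
  by exists (a + j) => r rp; rewrite E modz_small ?addrA//; lia.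
exists (a + j - (W + G)%N%:Z) => r rp; rewrite E.
have [jr|jr] := ltP (j + r%:Z) (W + G)%N%:Z.
  by rewrite modz_small; [rewrite {1}/window ifF//; lia|lia].
have -> : j + r%:Z = 1 * (W + G)%N%:Z + (j + r%:Z - (W + G)%N%:Z) by lia.
rewrite modzMDl modz_small; last by lia.
by rewrite leq_eqVlt; apply/orP; left; apply/eqP; congr window; lia.
Qed.

Lemma periodization_periodic x a W G i :
  periodization x a W G (i + (W + G)%N%:Z) = periodization x a W G i.
Proof. by rewrite /periodization addrAC modzDr. Qed.

Lemma periodization_eq x a W G i : a <= i < a + W%:Z ->
  periodization x a W G i = x i.
Proof.
move=> aiW; rewrite /periodization modz_small; last lia.
by rewrite addrC subrK /window aiW.
Qed.

Lemma cvg_config (y : nat -> config) (x : config) :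
  (forall i, \forall n \near \oo, y n i = x i) -> y @ \oo --> x.
Proof.
move=> yx; apply/cvg_sup => i A [_ [[B oB <-] Bx] sBA].
apply: filterS (yx i) => n yni; apply: sBA.
by rewrite /preimage/= /proj yni.
Qed.

Section Dense.
Variables (R : realType) (f : nat -> R) (alpha : R).
Hypotheses (alpha_gt0 : 0 < alpha) (f_ge : forall p, alpha * p%:R <= f p).
Let X := bounded_density_shift f.

(** Short stretches inherit the constraints of x and have sum at most
    S = sum of w. Cutting a stretch of length p into pieces of length G gives a
    sum of at most S + p S / G <= alpha G / 2 + alpha p / 2, which is at most
    alpha p <= f p as soon as p > G. *)
Lemma periodization_bounded_density x a W G : X x ->
  2 * (\sum_(k < W) x (a + (k : nat)%:Z)%R)%N%:R <= alpha * G%:R ->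
  (0 < G)%N -> X (periodization x a W G).
Proof.
move=> Xx; set y := periodization x a W G; set S := (\sum_(k < W) _)%N => SG G0.
have short i p : (0 < p <= G)%N -> (\sum_(r < p) y (i + (r : nat)%:Z)%R <= S)%N /\
    (\sum_(r < p) y (i + (r : nat)%:Z)%R)%N%:R <= f p.
  move=> /andP[p0 pG]; have [i' yi'] := periodization_window x a W i pG.
  have yw : (\sum_(r < p) y (i + (r : nat)%:Z)%R <=
      \sum_(r < p) window x a W (i' + (r : nat)%:Z)%R)%N.
    by apply: leq_sum => r _; exact: yi'.
  split; first exact: leq_trans yw (sum_window_le _ _ _ _ _).
  apply: le_trans (Xx p p0 i'); rewrite ler_nat; apply: leq_trans yw _.
  by apply: leq_sum => r _; rewrite /window; case: ifP.
have long p i : (\sum_(r < p) y (i + (r : nat)%:Z)%R)%N%:R <= S%:R + alpha / 2 * p%:R.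
  elim/ltn_ind: p i => p IH i; have [pG|Gp] := leqP p G.
    apply: le_trans (_ : S%:R <= _); last first.
      by rewrite lerDl mulr_ge0// divr_ge0// ltW.
    rewrite ler_nat; case: p pG {IH} => [|p pG]; first by rewrite big_ord0.
    by have [] := short i p.+1 pG.
  have -> : p = (G + (p - G))%N by rewrite subnKC// ltnW.
  rewrite big_split_ord/= !natrD.
  have GG : (0 < G <= G)%N by rewrite G0 leqnn.
  have [SG' _] := short i G GG; have pGp : (p - G < p)%N by lia.
  move: SG' (IH _ pGp (i + G%:Z)).
  under [X in _ -> X%:R <= _ -> _]eq_bigr do rewrite -addrA -PoszD.
  rewrite -(ler_nat R); lra.
move=> p p0 i; have [pG|Gp] := leqP p G; first by have [|] := short i p; rewrite ?p0.
apply: le_trans (long p i) _; apply: le_trans (f_ge p).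
have : alpha * G%:R <= alpha * p%:R by rewrite ler_pM2l// ler_nat ltnW.
lra.
Qed.

(** x is the limit of the periodizations of its words on [- N, N). *)
Lemma dense_periodic_points :
  X `<=` closure (\bigcup_(P in [set P | (0 < P)%N]) periodic_points X P).
Proof.
move=> x Xx.
have /choice[G GP] : forall N, exists G,
    (0 < G)%N /\ X (periodization x (- N%:Z) (N + N) G).
  move=> N.
  set S : R := (\sum_(k < N + N) x (- N%:Z + (k : nat)%:Z)%R)%N%:R.
  (* the least integer G with G > 2 S / alpha *)
  exists (Num.truncn (2 * S / alpha)).+1; split => //.
  apply: periodization_bounded_density => //.
  by rewrite [leRHS]mulrC -ler_pdivrMr// ltW// truncnS_gt.
pose y N := periodization x (- N%:Z) (N + N) (G N).
have yx : y @ \oo --> x.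
  apply: cvg_config => i; exists `|i|.+1%N => // N /= iN.
  by apply: periodization_eq; lia.
move=> B /yx [N _ yB]; exists (y N); split; last exact: (yB N (leqnn N)).
have [GN XyN] := GP N.
exists (N + N + G N)%N; first by rewrite /= addn_gt0 GN orbT.
by split => //; apply/funext => i; rewrite iter_sigmaE; exact: periodization_periodic.
Qed.

End Dense.

Theorem corollary4p5 (R : realType) (f : nat -> R) :
  canonical_function f ->
  0 < htop R (bounded_density_shift f) ->
  surjunctive (bounded_density_shift f).
Proof.
move=> canf hpos.
apply: dense_periodic_surjunctive; first exact: bounded_density_shift_subshift.
(* Either f grows linearly, or its mean values f p / p are arbitrarily small. *)
have [[alpha alpha0 falpha]|noalpha] :=
    pselect (exists2 alpha, 0 < alpha & forall p, alpha * p%:R <= f p).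
  exact: dense_periodic_points alpha0 falpha.
suff h0 : htop R (bounded_density_shift f) = 0 by rewrite h0 ltxx in hpos.
apply/cvg_lim => //; apply: cvg_entropy0 => // e e0.
apply: contrapT => nop; apply: noalpha; exists e => // p.
have [->|p0] := posnP p; first by rewrite mulr0; case: canf => _ ->.
by rewrite leNgt; apply/negP => fp; apply: nop; exists p => //; exact: ltW.
Qed.
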